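(* Let $P$ be a countable meet-continuous dcpo such that every nonempty upper-bounded subset of $P$ has a supremum in $P$. Then the Scott space $\Sigma P$ is sober. Moreover, finite products of such dcpos satisfy the Scott product equality: if $P_1,\ldots,P_n$ are countable meet-continuous dcpos in each of which every nonempty upper-bounded subset has a supremum, then $\sigma\bigl(\prod_{i=1}^{n}P_i\bigr)=\prod_{i=1}^{n}\sigma(P_i)$. No least element of $P$ (or of the $P_i$) is assumed.
   Context: All posets and directed sets are nonempty; countable sets may be finite. A subset $D$ of a poset is directed if any two of its elements have a common upper bound in $D$. A dcpo is a poset in which every directed subset has a supremum. Write $\mathord{\downarrow}x=\{y:y\le x\}$ and $\mathord{\downarrow}A=\bigcup_{a\in A}\mathord{\downarrow}a$. For a dcpo $P$, an upper set $U\subseteq P$ is Scott open if for every directed $D\subseteq P$, $\bigvee D\in U$ implies $D\cap U\neq\emptyset$; the Scott open sets form the Scott topology $\sigma(P)$, and $\Sigma P=(P,\sigma(P))$ is the Scott space. A dcpo $P$ is meet-continuous if for every $x\in P$ and every directed $D\subseteq P$, $x\le\bigvee D$ implies $x\in\operatorname{cl}_{\sigma(P)}(\mathord{\downarrow}x\cap\mathord{\downarrow}D)$, where $\operatorname{cl}_{\sigma(P)}$ is closure in the Scott topology. A nonempty Scott-closed set $A$ is irreducible if any two open sets meeting $A$ have an intersection meeting $A$. $\Sigma P$ is sober if each irreducible closed set $A$ equals $\mathord{\downarrow}a$ for a unique $a\in P$. $\prod_i P_i$ carries the coordinatewise order, $\sigma(\prod_i P_i)$ is its Scott topology, and $\prod_i\sigma(P_i)$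 denotes the ordinary topological product of the Scott topologies. *)

(* Defs.v *)
From HB Require Import structures.
From mathcomp Require Import all_boot all_order.
From mathcomp Require Import boolp classical_sets functions cardinality.
From mathcomp Require Import topology function_spaces.

Set Implicit Arguments.
Unset Strict Implicit.
Unset Printing Implicit Defensive.

Import Order.TTheory.
Local Open Scope classical_set_scope.
Local Open Scope order_scope.

Section Posets.
Variables (d : Order.disp_t) (P : porderType d).

Definition directed (D : set P) : Prop :=
  D !=set0 /\
  forall x y, D x -> D y -> exists z, [/\ D z, x <= z & y <= z].

(* A poset is nonempty by convention, whereas a [porderType] may be empty. *)
Definition is_dcpo : Prop :=
  [set: P] !=set0 /\ forall D : set P, directed D -> exists s, isLub D s.

Definition bounded_complete : Prop :=
  forall A : set P, A !=set0 -> has_ubound A -> exists s, isLub A s.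

Definition upper_set (U : set P) : Prop := forall x y, U x -> x <= y -> U y.

(* The supremum of [D] enters as any [s] with [isLub D s], so that the
   definition makes sense on every poset; on a dcpo such an [s] always exists,
   and it is unique. *)
Definition scott_open (U : set P) : Prop :=
  upper_set U /\
  forall (D : set P) (s : P),
    directed D -> isLub D s -> U s -> (D `&` U) !=set0.

Lemma scott_openT : scott_open setT.
Proof. by split=> // D s [[x Dx] _] _ _; exists x. Qed.

Lemma scott_openI : setI_closed scott_open.
Proof.
move=> U V [upU sU] [upV sV]; split.
  by move=> x y [Ux Vx] xy; split; [exact: upU xy|exact: upV xy].
move=> D s dD lubs [Us Vs].
have [x [Dx Ux]] := sU D s dD lubs Us.
have [y [Dy Vy]] := sV D s dD lubs Vs.
have [z [Dz xz yz]] := dD.2 x y Dx Dy.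
by exists z; split=> //; split; [exact: upU xz|exact: upV yz].
Qed.

Lemma scott_open_bigU (I : Type) (f : I -> set P) :
  (forall i, scott_open (f i)) -> scott_open (\bigcup_i f i).
Proof.
move=> fo; split.
  by move=> x y [i _ fix_] xy; exists i => //; exact: (fo i).1 xy.
move=> D s dD lubs [i _ fis].
have [x [Dx fx]] := (fo i).2 D s dD lubs fis.
by exists x; split=> //; exists i.
Qed.

End Posets.

Definition Sigma {d : Order.disp_t} (P : porderType d) : Type := P.

HB.instance Definition _ (d : Order.disp_t) (P : porderType d) :=
  Choice.on (Sigma P).
HB.instance Definition _ (d : Order.disp_t) (P : porderType d) :=
  isOpenTopological.Build (Sigma P)
    (@scott_openT d P) (@scott_openI d P) (@scott_open_bigU d P).

Lemma open_SigmaE (d : Order.disp_t) (P : porderType d) :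
  @open (Sigma P) = @scott_open d P.
Proof. by []. Qed.

Definition meet_continuous {d : Order.disp_t} (P : porderType d) : Prop :=
  forall (x : P) (D : set P) (s : P),
    directed D -> isLub D s -> x <= s ->
    closure (down [set x] `&` down D : set (Sigma P)) x.

Definition irreducible_closed {T : topologicalType} (A : set T) : Prop :=
  [/\ A !=set0, closed A &
      forall U V : set T, open U -> open V ->
        (U `&` A) !=set0 -> (V `&` A) !=set0 -> (U `&` V `&` A) !=set0].

Definition Scott_sober {d : Order.disp_t} (P : porderType d) : Prop :=
  forall A : set (Sigma P), irreducible_closed A ->
    exists! a : P, A = down [set a].

Section ProductPoset.
Variables (I : Type) (d : I -> Order.disp_t) (P : forall i, porderType (d i)).

Definition prod_poset : Type := forall i, P i.

HB.instance Definition _ := Choice.copy prod_poset (forall i, P i).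

Definition prod_le (f g : prod_poset) : bool := `[< forall i, f i <= g i >].

Lemma prod_le_refl : reflexive prod_le.
Proof. by move=> f; apply/asboolP. Qed.

Lemma prod_le_anti : antisymmetric prod_le.
Proof.
move=> f g /andP[/asboolP fg /asboolP gf].
by apply/functional_extensionality_dep => i; apply/le_anti; rewrite fg gf.
Qed.

Lemma prod_le_trans : transitive prod_le.
Proof.
move=> g f h /asboolP fg /asboolP gh; apply/asboolP => i.
exact: le_trans (fg i) (gh i).
Qed.

HB.instance Definition _ :=
  Order.Le_isPOrder.Build (Order.Disp tt tt) prod_poset
    prod_le_refl prod_le_anti prod_le_trans.

End ProductPoset.

(* Main.v *)
(* Let [P] be as in the theorem. If [D] is directed and [a] is below its
   supremum, meet-continuity and bounded joins make the trace of [down D] on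
   [down a] directed with supremum [a]. Combined with a diagonal argument over
   the countable [P], this yields countably many directed sets that suffice to
   test Scott openness of upper sets, although [P] may have uncountably many
   ideals. A Scott open box around a point of a Scott open subset of a finite
   product is then a union of boxes spanned by finitely many points, enlarged
   one test at a time, which gives the product equality.
   For sobriety, the pairs with an upper bound in a Scott closed set form a
   Scott closed subset of the square; if this set is irreducible, the product
   equality makes it directed, so that it contains its supremum. *)

Require Import Defs.
From mathcomp Require Import all_boot all_order.
From mathcomp Require Import boolp classical_sets functions cardinality.
From mathcomp Require Import topology function_spaces.

Local Open Scope classical_set_scope.

Import Order.TTheory.

(** Serves two stagewise constructions; the index of [R] tells which element or test a stage has to
    treat. *)
Lemma dependent_choice_inv {X : Type} (Inv : X -> Prop)
    (R : nat -> X -> X -> Prop) (x0 : X) :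
  (forall n x, Inv x -> exists y, Inv y /\ R n x y) -> Inv x0 ->
  exists f : nat -> X,
    f 0%N = x0 /\ forall n, Inv (f n) /\ R n (f n) (f n.+1).
Proof.
move=> stepP Inv0.
have /choice[step stepE] (nx : nat * X) :
    exists y, Inv nx.2 -> Inv y /\ R nx.1 nx.2 y.
  have [/(stepP nx.1)[y yP]|nInv] := pselect (Inv nx.2); first by exists y.
  by exists x0.
pose f n := iteri n (fun k x => step (k, x)) x0.
have fInv n : Inv (f n) by elim: n => //= n IHn; have [] := stepE (n, f n) IHn.
exists f; split=> // n; split=> //.
exact: (stepE (n, f n) (fInv n)).2.
Qed.

Lemma countable_code (T : Type) :
  countable [set: T] -> exists c : T -> nat, injective c.
Proof.
by move=> /countable_injP[c cinj]; exists c => x y; apply: cinj; rewrite inE.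
Qed.

(** * Traces of directed sets and tests for Scott openness in one poset *)

Section Posets.
Context {d : Order.disp_t} {P : porderType d}.
Implicit Types (D V : set P) (a s w x y : P).

Lemma directed_finite_ub D (T : finType) (f : T -> P) :
  directed D -> (forall i, D (f i)) -> exists2 u, D u & forall i, (f i <= u)%O.
Proof.
move=> [[x0 Dx0] dD] Df.
suff [u Du uP] : exists2 u, D u & forall i, i \in enum T -> (f i <= u)%O.
  by exists u => // i; apply: uP; rewrite mem_enum.
elim: (enum T) => [|j s [u Du uP]]; first by exists x0.
have [z [Dz uz jz]] := dD u (f j) Du (Df j).
exists z => // i; rewrite inE => /predU1P[->//|/uP iu].
exact: le_trans iu uz.
Qed.

Lemma scott_open_notdown a : scott_open (~` down [set a]).
Proof.
split=> [x y nx xy [_ [-> ya]]|D s dD [_ lubs] ns].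
  by apply: nx; exists a; split=> //; exact: le_trans ya.
apply: contrapT => nD; apply: ns; exists a; split=> //.
apply: lubs => x Dx; apply: contrapT => xa; apply: nD; exists x; split=> //.
by case=> _ [-> xa'].
Qed.

Lemma closed_down1 a : closed (down [set a] : set (Sigma P)).
Proof. by rewrite -openC; exact: scott_open_notdown. Qed.

Lemma scott_closed_sup (A : set (Sigma P)) D s :
  closed A -> directed D -> isLub D s -> D `<=` A -> A s.
Proof.
move=> cA dD lubs DA; apply: contrapT => nAs.
have [_ /(_ D s dD lubs nAs)[x [/DA]]//] : scott_open (~` A : set P).
by move: cA; rewrite -openC.
Qed.

Lemma scott_closed_lower (A : set (Sigma P)) (x y : P) :
  closed A -> A y -> (x <= y)%O -> A x.
Proof.
rewrite -openC => -[up _] Ay xy; apply: contrapT => nAx.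
exact: up nAx xy Ay.
Qed.

Hypotheses (dcpoP : is_dcpo P) (mcP : meet_continuous P)
           (bcP : bounded_complete P).

Lemma bounded_join x y a : (x <= a)%O -> (y <= a)%O ->
  exists z, [/\ (x <= z)%O, (y <= z)%O &
             forall b, (x <= b)%O -> (y <= b)%O -> (z <= b)%O].
Proof.
move=> xa ya; have [||z [ubz lubz]] := bcP [set x; y].
- by exists x; left.
- by exists a => _ [->|->].
exists z; split; [by apply: ubz; left|by apply: ubz; right|].
by move=> b xb yb; apply: lubz => _ [->|->].
Qed.

(** Joins of pairs below [a] stay below any common bound in [D], so they stay in the trace. If [b]
    bounds the trace, the closed set [down [set b]] contains its closure, hence [a]. *)
Lemma meet_continuous_trace D s a :
  directed D -> isLub D s -> (a <= s)%O ->
  directed (down [set a] `&` down D) /\ isLub (down [set a] `&` down D) a.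
Proof.
move=> dD lubs as_; set J := _ `&` _; have clJ := mcP _ _ _ dD lubs as_.
have dJ : directed J.
  split.
    by have [x [Jx _]] := clJ setT filterT; exists x.
  move=> x y [[_ [-> xa]] [p [Dp xp]]] [[_ [-> ya]] [q [Dq yq]]].
  have [r [Dr pr qr]] := dD.2 p q Dp Dq.
  have [z [xz yz zmin]] := bounded_join _ _ _ xa ya.
  exists z; split=> //; split; first by exists a; split=> //; exact: zmin.
  by exists r; split=> //; apply: zmin; [exact: le_trans pr|exact: le_trans qr].
split=> //; split; first by move=> x [[_ [-> xa]] _].
move=> b ubb.
suff [_ [-> //]] : down [set b] a.
apply: (closed_down1 b); apply: closure_subset clJ => x Jx.
by exists b; split=> //; exact: ubb.
Qed.

Hypothesis countP : countable [set: P].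

(* [I s w] is a directed set through [w] with supremum [s] not containing [s],
   when there is one. Suppose [V] passes the tests but misses a directed [D].
   Choose [a n] decreasing in [V] and [w n] increasing in [down D] with
   [w n <= a n]; at step [n], the element [p] of code [n] is kept out of the
   interval from [w n.+1] to [a n.+1], by raising [w n] above some element not
   below [p] if [a n] is not below [p], and otherwise by replacing [a n] with a
   smaller point of [V] taken from [I (a n) (w n)]. Then the supremum of the
   [w n] has no code. *)
Lemma scott_open_tests : exists I : P -> P -> set P,
  (forall s w, directed (I s w) /\ isLub (I s w) s) /\
  forall V, upper_set V -> (forall s w, V s -> (I s w `&` V) !=set0) ->
    scott_open V.
Proof.
have [c cinj] := countable_code _ countP.
pose proper s w D := [/\ directed D, isLub D s, D w & ~ D s].
have /choice[I IP] (sw : P * P) : exists D,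
    [/\ directed D, isLub D sw.1 &
        (exists D', proper sw.1 sw.2 D') -> proper sw.1 sw.2 D].
  case: sw => s w /=; have [[D DP]|nD] := pselect (exists D, proper s w D).
    by exists D; case: (DP).
  exists [set s]; split=> //; last first.
    by split=> [x ->//|b]; apply.
  by split; [exists s|move=> _ _ -> ->; exists s].
exists (fun s w => I (s, w)); split; first by move=> s w; case: (IP (s, w)).
move=> V upV testV; split=> // D s dD lubs Vs.
apply: contrapT => DV.
have VD x : V x -> ~ down D x.
  by move=> Vx [y [Dy xy]]; apply: DV; exists y; split=> //; exact: upV xy.
pose Inv (aw : P * P) :=
  [/\ V aw.1, (aw.1 <= s)%O, down D aw.2 & (aw.2 <= aw.1)%O].
pose R n (aw bv : P * P) := [/\ (bv.1 <= aw.1)%O, (aw.2 <= bv.2)%O &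
  forall p, c p = n -> (bv.2 <= p)%O -> ~ (p <= bv.1)%O].
have step n aw : Inv aw -> exists bv, Inv bv /\ R n aw bv.
  case: aw => a w [/= Va as_ Dw wa].
  have [dJ lubJ] := meet_continuous_trace _ _ _ dD lubs as_.
  have Jw : (down [set a] `&` down D) w by split=> //; exists a.
  have [[p cp]|np] := pselect (exists p, c p = n); last first.
    by exists (a, w); do 2!split=> //; move=> p cp; case: np; exists p.
  have [ap|nap] := pselect (a <= p)%O.
    (* The trace itself is a proper candidate: it omits [a] because [V] misses [down D]. *)
    have [dI lubI Iw nIa] : proper a w (I (a, w)).
      case: (IP (a, w)) => _ _; apply; exists (down [set a] `&` down D).
      by split=> // -[_]; exact: VD.
    have [b [Ib Vb]] := testV a w Va.
    (* Going above both [b] and [w] inside [I (a, w)] keeps [e] in [V] and above [w], yet different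
       from [a]. *)
    have [e [Ie be we]] := dI.2 b w Ib Iw.
    have ea : (e <= a)%O := lubI.1 e Ie.
    exists (e, w); split.
      by split=> //=; [exact: upV be|exact: le_trans as_].
    split=> //= q; rewrite -cp => /cinj -> _ pe.
    have {}ea : e = a by apply/le_anti; rewrite ea (le_trans ap).
    by apply: nIa; move: Ie; rewrite ea.
  have [j Jj njp] : exists2 j, (down [set a] `&` down D) j & ~ (j <= p)%O.
    apply: contrapT => nj; apply: nap; apply: lubJ.2 => j Jj.
    by apply: contrapT => njp; apply: nj; exists j.
  have [e [[[_ [-> ea]] De] we je]] := dJ.2 w j Jw Jj.
  exists (a, e); do 2!split=> //=.
  move=> q; rewrite -cp => /cinj -> ep _.
  by apply: njp; exact: le_trans ep.
have [w0 [[_ [-> w0s]] Dw0]] := (meet_continuous_trace _ _ _ dD lubs (lexx s)).1.1.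
have [f [_ fP]] := dependent_choice_inv Inv R (s, w0) step
  (And4 Vs (lexx s) Dw0 w0s).
pose a n := (f n).1; pose w n := (f n).2.
have wS n : (w n <= w n.+1)%O by case: (fP n) => _ [].
have aS n : (a n.+1 <= a n)%O by case: (fP n) => _ [].
have wa n : (w n <= a n)%O by case: (fP n) => -[].
have wmono m n : (m <= n)%N -> (w m <= w n)%O.
  by apply: (@homo_leq _ w (fun x y => (x <= y)%O)) => // y x z; exact: le_trans.
have amono m n : (m <= n)%N -> (a n <= a m)%O.
  apply: (@homo_leq _ a (fun x y => (y <= x)%O)) => // y x z xy yz.
  exact: le_trans xy.
have [|v [ubv lubv]] := dcpoP.2 (range w).
  split; first by exists (w 0%N), 0%N.
  move=> _ _ [m _ <-] [n _ <-]; exists (w (maxn m n)); split; first by eexists.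
    by apply: wmono; exact: leq_maxl.
  by apply: wmono; exact: leq_maxr.
(* Stage [c v] has expelled [v] from the interval between [w] and [a] at index [(c v).+1], where [v]
   must lie. *)
have [_ [_ _ /(_ v erefl)]] := fP (c v); apply.
  by apply: ubv; exists (c v).+1.
apply: lubv => _ [n _ <-]; have [nv|/ltnW vn] := leqP n (c v).+1.
  exact: le_trans (wmono _ _ nv) (wa _).
exact: le_trans (wa _) (amono _ _ vn).
Qed.

End Posets.

(** * Finite grids and open boxes in finite products *)

Section ProductPoset.
Context {I : finType} {d : I -> Order.disp_t} {P : forall i, porderType (d i)}.
Implicit Types (x y z : prod_poset P).

Definition coord_update y (i : I) (p : P i) : prod_poset P := dfwith y p.

Lemma prod_leP {y z} : reflect (forall i, (y i <= z i)%O) (y <= z)%O.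
Proof. exact: asboolP. Qed.

Lemma coord_update_le y i (p : P i) z :
  (coord_update y i p <= z)%O <->
  (p <= z i)%O /\ forall j, i != j -> (y j <= z j)%O.
Proof.
split=> [/prod_leP yz|[pz yz]].
  split; first by have := yz i; rewrite /coord_update dfwith_in.
  by move=> j ij; have := yz j; rewrite /coord_update dfwith_out.
apply/prod_leP => j; rewrite /coord_update.
have [ij|ij] := eqVneq i j; last by rewrite dfwith_out// yz.
by case: j / ij; rewrite dfwith_in.
Qed.

Lemma coord_update_in y i (p : P i) : coord_update y i p i = p.
Proof. exact: dfwith_in. Qed.

Lemma coord_update_out y i (p : P i) j : i != j -> coord_update y i p j = y j.
Proof. exact: dfwith_out. Qed.

Lemma coord_update_mono y i (p q : P i) :
  (p <= q)%O -> (coord_update y i p <= coord_update y i q)%O.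
Proof.
move=> pq; apply/coord_update_le; rewrite coord_update_in; split=> // j ij.
by rewrite coord_update_out.
Qed.

Lemma directed_coord_update y i (D : set (P i)) :
  directed D -> directed (coord_update y i @` D).
Proof.
move=> [[p Dp] dD]; split; first by exists (coord_update y i p), p.
move=> _ _ [a Da <-] [b Db <-]; have [e [De ae be]] := dD a b Da Db.
exists (coord_update y i e); split; first by exists e.
  exact: coord_update_mono.
exact: coord_update_mono.
Qed.

Lemma isLub_coord_update y i (D : set (P i)) (s : P i) :
  D !=set0 -> isLub D s -> isLub (coord_update y i @` D) (coord_update y i s).
Proof.
move=> [p Dp] [ubs lubs]; split.
  by move=> _ [a Da <-]; apply: coord_update_mono; exact: ubs.
move=> b ubb; have le_b a (Da : D a) : (coord_update y i a <= b)%O.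
  by apply: ubb; exists a.
apply/coord_update_le; split.
  by apply: lubs => a /le_b/coord_update_le[].
by have /coord_update_le[] := le_b p Dp.
Qed.

Lemma scott_open_coord_update (U : set (prod_poset P)) y i
    (D : set (P i)) (s : P i) :
  scott_open U -> directed D -> isLub D s -> U (coord_update y i s) ->
  exists2 p, D p & U (coord_update y i p).
Proof.
move=> [_ sU] dD lubs Us.
have [_ [[p Dp <-] Up]] :=
  sU _ _ (directed_coord_update y i D dD) (isLub_coord_update y i D s dD.1 lubs) Us.
by exists p.
Qed.

Lemma directed_proj (i : I) (D : set (prod_poset P)) :
  directed D -> directed [set y i | y in D].
Proof.
move=> [[y Dy] dD]; split; first by exists (y i), y.
move=> _ _ [a Da <-] [b Db <-].
have [e [De /prod_leP ae /prod_leP be]] := dD a b Da Db.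
by exists (e i); split=> //; exists e.
Qed.

Lemma isLub_proj (i : I) (D : set (prod_poset P)) (s : prod_poset P) :
  isLub D s -> isLub [set y i | y in D] (s i).
Proof.
move=> [ubs lubs]; split; first by move=> _ [y /ubs/prod_leP ys <-].
(* Replacing coordinate [i] of [s] by [b] still bounds [D]. *)
move=> b ubb; have /prod_leP/(_ i) : (s <= coord_update s i b)%O.
  apply: lubs => y Dy; apply/prod_leP => j.
  have [ij|ij] := eqVneq i j; last first.
    by rewrite coord_update_out//; have /prod_leP := ubs y Dy.
  by case: j / ij; rewrite coord_update_in; apply: ubb; exists y.
by rewrite coord_update_in.
Qed.

(** The points [y] form the finite grid generated by [t]: different coordinates may come from
    different members. *)
Definition spans_in (U : set (prod_poset P)) (t : seq (prod_poset P)) : Prop :=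
  forall y, (forall i, exists2 z, z \in t & y i = z i) -> U y.

(** Each grid point stays in [U] when its coordinate [i] becomes [s], hence already for some element
    of [D]. The grid is finite, so one element of [D] serves all its points. *)
Lemma spans_in_extend (U : set (prod_poset P)) x t i (D : set (P i)) (s : P i) :
  scott_open U -> x \in t -> spans_in U t -> directed D -> isLub D s ->
  (exists2 z, z \in t & (z i <= s)%O) ->
  exists t', [/\ {subset t <= t'}, spans_in U t' & exists2 z, z \in t' & D (z i)].
Proof.
move=> oU xt Ut dD lubs [z0 z0t z0s].
pose yg (g : {ffun I -> 'I_(size t)}) : prod_poset P :=
  fun j => nth x t (g j) j.
have /choice[u uP] g : exists p, D p /\ U (coord_update (yg g) i p).
  have [|p Dp Up] := scott_open_coord_update U (yg g) i D s oU dD lubs.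
    apply: (oU.1 _ _ _ (coord_update_mono (yg g) i _ _ z0s)).
    apply: Ut => j; have [ij|ij] := eqVneq i j.
      by exists z0 => //; case: j / ij; rewrite coord_update_in.
    by exists (nth x t (g j)); rewrite ?mem_nth ?coord_update_out.
  by exists p.
have [e De ue] := directed_finite_ub D _ u dD (fun g => (uP g).1).
(* The new member agrees with [x] off [i], so the grid gains only the value [e] at coordinate
   [i]. *)
exists (rcons t (coord_update x i e)); split.
- by move=> z zt; rewrite mem_rcons inE zt orbT.
- move=> y yt; have yt' j : i != j -> exists2 z, z \in t & y j = z j.
    move=> ij; have [z] := yt j; rewrite mem_rcons inE => /predU1P[->|]; last first.
      by exists z.
    by rewrite coord_update_out//; exists x.
  have [z] := yt i; rewrite mem_rcons inE => /predU1P[->|zt yz]; last first.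
    apply: Ut => j; have [ij|ij] := eqVneq i j; last exact: yt'.
    by case: j / ij; exists z.
  rewrite coord_update_in => ye.
  have /choice[g gP] j : exists k : 'I_(size t), i != j -> y j = nth x t k j.
    have [ij|/yt'[z' z't ->]] := eqVneq i j.
      (* Any index would do at coordinate [i], which gets overwritten; that of [x] is a default. *)
      by have lt_x := xt; rewrite -index_mem in lt_x; exists (Ordinal lt_x).
    by have lt_z := z't; rewrite -index_mem in lt_z; exists (Ordinal lt_z);
      rewrite /= nth_index.
  apply: (oU.1 _ _ (uP (finfun g)).2); apply/coord_update_le.
  by rewrite ye ue; split=> // j ij; rewrite /yg ffunE gP.
- by exists (coord_update x i e); rewrite ?mem_rcons ?mem_head ?coord_update_in.
Qed.

(** [V i] is the upper closure of the [i]-th coordinates of all points ever listed. It passes every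
    test, since each test recurs after any given stage; a point of the box involves only finitely
    many stages, so it lies above a grid point. *)
Lemma scott_open_prod_box (U : set (prod_poset P)) x :
  (forall i, countable [set: P i]) -> (forall i, is_dcpo (P i)) ->
  (forall i, meet_continuous (P i)) -> (forall i, bounded_complete (P i)) ->
  scott_open U -> U x ->
  exists V : forall i, set (P i),
    (forall i, scott_open (V i) /\ V i (x i)) /\
    forall y, (forall i, V i (y i)) -> U y.
Proof.
move=> cP dcpoP mcP bcP oU Ux.
pose c i := sval (cid (countable_code _ (cP i))).
have cinj i : injective (c i) := svalP (cid (countable_code _ (cP i))).
pose T i := sval (cid (scott_open_tests (dcpoP i) (mcP i) (bcP i) (cP i))).
have TP i := svalP (cid (scott_open_tests (dcpoP i) (mcP i) (bcP i) (cP i))).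
pose Inv t := x \in t /\ spans_in U t.
(* Step [n] runs the test coded by the 2-adic valuation of [n], so that every
   test is run infinitely often. *)
pose R n (t t' : seq (prod_poset P)) := {subset t <= t'} /\
  forall i s w, logn 2 n = pickle (i, c i s, c i w) ->
    (exists2 z, z \in t & (z i <= s)%O) -> exists2 z, z \in t' & T i s w (z i).
have step n t : Inv t -> exists t', Inv t' /\ R n t t'.
  move=> [xt Ut].
  pose active i s w := logn 2 n = pickle (i, c i s, c i w) /\
    exists2 z, z \in t & (z i <= s)%O.
  have [[i [s [w [code_n zs]]]]|none] :=
      pselect (exists i s w, active i s w); last first.
    exists t; split=> //; split=> // i s w code_n zs; case: none.
    by exists i, s, w.
  have [dT lubT] := (TP i).1 s w.
  have [t' [tt' Ut' Tt']] := spans_in_extend U x t i _ s oU xt Ut dT lubT zs.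
  exists t'; split; first by split=> //; exact: tt'.
  (* Codes are injective, so a stage runs at most one test and one extension suffices. *)
  split=> // j s' w'; rewrite code_n => /(pcan_inj pickleK)[ij].
  by case: j / ij s' w' => s' w' /cinj <- /cinj <-.
have [|f [f0 fP]] := dependent_choice_inv Inv R [:: x] step.
  split; first by rewrite mem_head.
  move=> y yx; suff -> : y = x by [].
  by apply: functional_extensionality_dep => i;
    have [z] := yx i; rewrite inE => /eqP->.
have fS n : {subset f n <= f n.+1} by case: (fP n) => _ [].
have fmono m n : (m <= n)%N -> {subset f m <= f n}.
  apply: (@homo_leq _ f (fun s t => {subset s <= t})) => [s z|t r s rt ts z zr|].
  - by [].
  - by apply: ts; exact: rt.
  - exact: fS.
pose V i : set (P i) := [set p | exists n, exists2 z, z \in f n & (z i <= p)%O].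
exists V; split=> [i|y Vy].
  split; last by exists 0%N, x; rewrite ?f0 ?mem_head.
  apply: (TP i).2 => [p q [n [z zn zp]] pq|s w [m [z zm zs]]].
    by exists n, z => //; exact: le_trans pq.
  (* The factor [3 ^ m] leaves the 2-adic valuation at [k] and puts the stage after [m], when [z] is
     already listed. *)
  pose k := pickle (i, c i s, c i w); pose n := (2 ^ k * 3 ^ m)%N.
  have [||z' z'n Tz'] := (fP n).2.2 i s w.
  - by rewrite lognM ?expn_gt0// pfactorK// lognX muln0 addn0.
  - exists z => //; apply: fmono zm; apply: (@leq_trans (3 ^ m)%N).
      by rewrite ltnW// ltn_expl.
    by rewrite leq_pmull// expn_gt0.
  by exists (z' i); split=> //; exists n.+1, z'.
have /choice[n nP] i : exists n, exists2 z, z \in f n & (z i <= y i)%O by exact: Vy.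
pose N := (\max_i n i)%N.
have zP i : exists z, z \in f N /\ (z i <= y i)%O.
  have [z zn zy] := nP i; exists z; split=> //.
  by apply: fmono zn; exact: leq_bigmax.
have /choice[z zE] := zP.
apply: (oU.1 (fun i => z i i)); last by apply/prod_leP => i; exact: (zE i).2.
by apply: (fP N).1.2 => i; exists (z i) => //; exact: (zE i).1.
Qed.

End ProductPoset.

(** * Sobriety *)

(** If all families in [D] are bounded in [A], their joins form a directed subset of [A], whose
    supremum lies in [A] and bounds the supremum of [D]. The index [i0] makes the ranges
    nonempty. *)
Lemma scott_open_unbounded_in {I : finType} {d : Order.disp_t} {P : porderType d}
    (i0 : I) (A : set (Sigma P)) :
  is_dcpo P -> bounded_complete P -> closed A ->
  scott_open [set f : prod_poset (fun _ : I => P) |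
    ~ exists2 u : P, A u & forall i, (f i <= u)%O].
Proof.
move=> dcpoP bcP cA; split=> [f g nf fg [u Au gu]|D s dD lubs nbd].
  by apply: nf; exists u => // i; apply: le_trans (gu i); exact/(asboolP _ fg).
apply: contrapT => nD; apply: nbd.
have Dbd f : D f -> exists2 u : P, A u & forall i, (f i <= u)%O.
  by move=> Df; apply: contrapT => nu; apply: nD; exists f.
pose E := [set z : P | exists2 f, D f & isLub (range f) z].
have EP f : D f -> exists2 z, E z & isLub (range f) z.
  move=> Df; have [u _ fu] := Dbd f Df.
  have [||z zP] := bcP (range f); first by exists (f i0), i0.
    by exists u => _ [i _ <-].
  by exists z => //; exists f.
have dE : directed E.
  split; first by have [f /EP[z Ez _]] := dD.1; exists z.
  move=> x y [f Df [_ lubf]] [g Dg [_ lubg]].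
  have [h [Dh /asboolP fh /asboolP gh]] := dD.2 f g Df Dg.
  have [z Ez [ubz _]] := EP h Dh; exists z; split=> //.
    by apply: lubf => _ [i _ <-]; apply: le_trans (fh i) _; apply: ubz; exists i.
  by apply: lubg => _ [i _ <-]; apply: le_trans (gh i) _; apply: ubz; exists i.
have [t lubt] := dcpoP.2 E dE; exists t.
  apply: (scott_closed_sup _ _ _ cA dE lubt) => z [f Df [_ lubf]].
  have [u Au fu] := Dbd f Df; apply: (scott_closed_lower _ _ _ cA Au).
  by apply: lubf => _ [i _ <-].
move=> i; have [_] := isLub_proj i D s lubs; apply=> _ [f Df <-].
have [z Ez [ubz _]] := EP f Df; apply: le_trans (lubt.1 z Ez).
by apply: ubz; exists i.
Qed.

Lemma scott_sober {d : Order.disp_t} {P : porderType d} :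
  countable [set: P] -> is_dcpo P -> meet_continuous P -> bounded_complete P ->
  Scott_sober P.
Proof.
move=> cP dcpoP mcP bcP A [A0 cA irrA].
have dA : directed (A : set P).
  split=> // a b Aa Ab; apply: contrapT => nub.
  have oU := scott_open_unbounded_in true A dcpoP bcP cA.
  have [|V [VP VU]] := scott_open_prod_box (P := fun _ : bool => P) _
    (fun i => if i then a else b) (fun=> cP) (fun=> dcpoP) (fun=> mcP)
    (fun=> bcP) oU.
    move=> [u Au fu]; apply: nub; exists u; split=> //.
      exact: (fu true).
    exact: (fu false).
  have [||c [[Vtc Vfc] Ac]] := irrA (V true) (V false) (VP true).1 (VP false).1.
  - by exists a; split=> //; exact: (VP true).2.
  - by exists b; split=> //; exact: (VP false).2.
  (* The constant pair at [c] lies in the box, yet [c] bounds it in [A]. *)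
  by have [|] := VU (fun=> c); [by case|exists c].
have [t lubt] := dcpoP.2 _ dA.
have At : A t by exact: (scott_closed_sup _ _ _ cA dA lubt).
exists t; split.
  apply/seteqP; split=> [x Ax|x [_ [-> xt]]]; last first.
    exact: (scott_closed_lower _ _ _ cA At).
  by exists t; split=> //; exact: lubt.1.
move=> t' At'; have A't' : A t' by rewrite At'; exists t'.
have [_ [-> tt']] : down [set t'] t by rewrite -At'.
by apply/le_anti; rewrite tt'; apply: lubt.1.
Qed.

(** * The product equality *)

Lemma scott_open_prodE {I : finType} {d : I -> Order.disp_t}
    {P : forall i, porderType (d i)} :
  (forall i, countable [set: P i]) -> (forall i, is_dcpo (P i)) ->
  (forall i, meet_continuous (P i)) -> (forall i, bounded_complete (P i)) ->
  [set U : set (prod_poset P) | @open (Sigma (prod_poset P)) U] =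
  [set U : set (prod_poset P) |
     @open (prod_topology (fun i => Sigma (P i))) U].
Proof.
move=> cP dcpoP mcP bcP; apply/seteqP; split=> U oU /=.
  rewrite openE => x Ux.
  have [V [VP VU]] := scott_open_prod_box U x cP dcpoP mcP bcP oU Ux.
  have Vx i : nbhs (x : prod_topology (fun i => Sigma (P i))) [set y | V i (y i)].
    apply: (@proj_continuous _ (fun i => Sigma (P i)) i x (V i)).
    by apply: (@open_nbhs_nbhs (Sigma (P i))); case: (VP i).
  apply: (filterS VU).
  (* Finiteness of [I] lets the coordinate neighbourhoods be intersected. *)
  exact: (filter_forall (nbhs_filter (x : prod_topology (fun i => Sigma (P i)))) Vx).
rewrite openE => x Ux.
(* Projections preserve directed suprema, hence are Scott continuous, so the Scott topology refines
   the product topology. *)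
have id_cont : nbhs (x : Sigma (prod_poset P)) -->
    (x : prod_topology (fun i => Sigma (P i))).
  apply/cvg_sup => i B.
  rewrite (@nbhsE (initial_topology (fun f : prod_poset P => f i : Sigma (P i)))).
  move=> -[_ [[W oW <-] Wx] WB].
  apply: (@filterS _ _ (nbhs_filter (x : Sigma (prod_poset P))) _ _ WB).
  apply: (@open_nbhs_nbhs (Sigma (prod_poset P)) x); split=> //; split.
    by move=> y z Wy /prod_leP yz; apply: oW.1 Wy (yz i).
  move=> D s dD lubs Ws.
  have [_ [[y Dy <-] Wy]] :=
    oW.2 _ _ (directed_proj i D dD) (isLub_proj i D s lubs) Ws.
  by exists y.
by apply: id_cont; exact: open_nbhs_nbhs.
Qed.

Theorem proposition4p3 :
  (forall (d : Order.disp_t) (P : porderType d),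
     countable [set: P] -> is_dcpo P -> meet_continuous P ->
     bounded_complete P ->
     Scott_sober P)
  /\
  (forall (n : nat) (d : 'I_n -> Order.disp_t)
          (P : forall i : 'I_n, porderType (d i)),
     (forall i, countable [set: P i]) -> (forall i, is_dcpo (P i)) ->
     (forall i, meet_continuous (P i)) -> (forall i, bounded_complete (P i)) ->
     [set U : set (prod_poset P) | @open (Sigma (prod_poset P)) U] =
     [set U : set (prod_poset P) |
        @open (prod_topology (fun i => Sigma (P i))) U]).
Proof.
split=> [d P|n d P]; first exact: scott_sober.
exact: scott_open_prodE.
Qed.
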